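(* Let $G$ be a $\Theta$-graph such that, for every $p$, $G$ is (up to isomorphism) neither $\Theta_{p,p,p}$ nor $\Theta_{p,p,p+2}$. Then $\mathrm{dim}(G)<2c(G)-1$.
   Context: All graphs are finite, simple and connected. A $\Theta$-graph is a graph with precisely two vertices $u,v$ of degree $3$, all other vertices of degree $2$, in which $u$ and $v$ are joined by three internally vertex-disjoint paths. It is denoted $\Theta_{p,q,r}$ when these three paths have lengths (numbers of edges) $p\le q\le r$; since graphs are simple, $q\ge 2$ (so $\Theta_{p,p,p}$ and $\Theta_{p,p,p+2}$ occur only for $p\ge 2$). For vertices $x,y$ of a graph $G$, $d(x,y)$ is the length of a shortest path between them. A vertex $s$ distinguishes two vertices $x,x'$ if $d(s,x)\neq d(s,x')$. A set $S\subseteq V(G)$ is a vertex metric generator if every pair of distinct vertices of $G$ is distinguished by some $s\in S$. The vertex metric dimension $\mathrm{dim}(G)$ is the size of a smallest vertex metric generator of $G$. The cyclomatic number of $G$ is $c(G)=|E(G)|-|V(G)|+1$. *)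

(* Defs.v *)
(* Mathematical Components *)
From mathcomp Require Import all_boot all_order all_algebra.

Set Implicit Arguments.
Unset Strict Implicit.
Unset Printing Implicit Defensive.

Import GRing.Theory.

Record graph := Graph {
  vertex :> finType;
  adj : rel vertex;
  adj_sym : symmetric adj;
  adj_irr : irreflexive adj;
  graph_connected : forall x y : vertex, connect adj x y
}.

Section GraphNotions.
Variable G : graph.
Implicit Types (x y u v s : G) (P Q R : seq G) (S : {set G}).

Definition edges : {set {set G}} :=
  [set [set z.1; z.2] | z : G * G & adj z.1 z.2].

Definition degree x : nat := #|[set y | adj x y]|.

(* Integer valued, as subtraction on nat is truncated. *)
Definition cyclomatic : int := (#|edges|%:Z - #|G|%:Z + 1)%R.

(* As in path.v, the start vertex x is not an item of P, so that size P is
   the number of edges of the path. *)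
Definition is_path x y P : bool :=
  [&& path (@adj G) x P, uniq (x :: P) & last x P == y].

Definition interior x P : seq G := behead (belast x P).

Lemma is_path_exists x y :
  exists n, [exists P : n.-tuple G, is_path x y P].
Proof.
have /connectP[P0 pathP0 ->] := graph_connected x y.
case/shortenP: pathP0 => P pathP uniqP _.
exists (size P); apply/existsP; exists (in_tuple P).
by rewrite /is_path /= pathP eqxx andbT.
Qed.

Definition dist x y : nat := ex_minn (is_path_exists x y).

Definition distinguishes s x y : bool := dist s x != dist s y.

Definition metric_generator S : bool :=
  [forall x, forall y, (x != y) ==> [exists s in S, distinguishes s x y]].

Lemma dist_eq0 x y : (dist x y == 0) = (x == y).
Proof.
rewrite /dist; case: ex_minnP => n /existsP[P xPy] n_min.
apply/eqP/eqP => [n0 | xy].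
  move: P xPy {n_min}; rewrite n0 => P; rewrite tuple0.
  by case/and3P => _ _ /eqP.
apply/eqP; rewrite -leqn0; apply: n_min; apply/existsP.
by exists [tuple]; rewrite /is_path /= xy.
Qed.

Lemma metric_generator_setT : metric_generator setT.
Proof.
apply/forallP => x; apply/forallP => y; apply/implyP => xNy.
apply/existsP; exists x; rewrite inE /distinguishes.
have /eqP-> : dist x x == 0 by rewrite dist_eq0.
by rewrite eq_sym dist_eq0.
Qed.

(* The default setT is legitimate by metric_generator_setT. *)
Definition metric_dim : nat :=
  #|[arg min_(S < setT | metric_generator S) #|S|]|.

(* Paths of length 1 have an empty interior, hence disjointness of interiors
   alone would not prevent the edge uv from being used twice. *)
Definition internally_disjoint u P Q : bool :=
  (P != Q) && [disjoint interior u P & interior u Q].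

Definition is_theta (p q r : nat) : Prop :=
  p <= q <= r /\
  exists u v P Q R,
    [/\ u != v,
        degree u = 3 /\ degree v = 3,
        forall x, x != u -> x != v -> degree x = 2,
        [/\ is_path u v P, is_path u v Q & is_path u v R] &
        [/\ internally_disjoint u P Q, internally_disjoint u P R
          & internally_disjoint u Q R] /\
        [/\ size P = p, size Q = q & size R = r]].

Definition theta_graph : Prop := exists p q r, is_theta p q r.

End GraphNotions.

(* Main.v *)
Require Import Defs.
From mathcomp Require Import all_boot all_order all_algebra.
From mathcomp Require Import zify.

Set Implicit Arguments.
Unset Strict Implicit.
Unset Printing Implicit Defensive.

(** The cyclomatic number of a Theta-graph is at least 2: by the handshake
lemma, twice the number of edges is at least the sum of the degrees, which is
2 |V| + 2.  So it is enough to exhibit two vertices that distinguish all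
vertices.

Let u and v be the vertices of degree 3, joined by branches P, Q, R of lengths
p <= q <= r.  A vertex has a pair of coordinates: a branch, and a position
between 0 (at u) and the length of the branch (at v).  The distance from a
vertex s to a vertex x is the least length of four routes: the direct one along
a branch, or through u only if the branches differ; the one through v only;
and the two that traverse P between u and v, in either direction
([dist_point]).  To prove that a function f on vertices is the distance to s it
is enough that f vanishes at s, changes by at most 1 along an edge, and
decreases along some edge at every vertex other than s ([dist_potential]).

If p < q, write q = p + 2m + e with e = 0 or 1, and take the vertices at
positions m and m + p of Q.  These are antipodal, up to rounding when e = 1,
to v and to u respectively on the cycle formed by P and Q.  If e = 0, their
distances to the vertices of P and R are thus the distances from u and from v,
increased by m; if e = 1, this is still true of the first one, and almost of
the second ([route_lt], [resolving_lt]).  If p = q, then r is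
neither p nor p + 2, and the vertices at position 1 of P and of R distinguish
all vertices ([route_eq], [resolving_eq]). *)

(** * Distances and degrees in a connected graph *)

Section Distance.
Variable G : graph.
Implicit Types (x y s : G) (S : {set G}).

Lemma dist_le_size x (P : seq G) :
  path (@adj G) x P -> dist x (last x P) <= size P.
Proof.
case/shortenP => P' pathP' uniqP' subP.
have {subP}: size P' <= size P.
  by case/andP: uniqP' => _ uniqP'; apply: uniq_leq_size.
apply: leq_trans.
rewrite /dist; case: ex_minnP => n _; apply; apply/existsP.
by exists (in_tuple P'); rewrite /is_path pathP' uniqP' /=.
Qed.

Lemma dist_attained x y :
  exists P : seq G, [/\ path (@adj G) x P, last x P = y & size P = dist x y].
Proof.
rewrite /dist; case: ex_minnP => n /existsP[P /and3P[pathP _ /eqP lastP]] _.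
by exists P; rewrite size_tuple.
Qed.

(** A function that vanishes at s, grows by at most 1 along edges and decreases
along some edge at every vertex other than s is the distance to s. *)
Lemma dist_potential s (f : G -> nat) :
    f s = 0 ->
    (forall x y, adj x y -> f y <= (f x).+1) ->
    (forall x, x != s -> exists2 y, adj x y & f y < f x) ->
  forall x, dist s x = f x.
Proof.
move=> f0 f_lip f_desc x; apply/eqP; rewrite eqn_leq; apply/andP; split.
  have [n] := ubnP (f x); elim: n x => // n IHn x fx.
  have [-> | /f_desc[y xy fyx]] := eqVneq x s.
    by move: (dist_eq0 s s); rewrite eqxx => /eqP->.
  apply: leq_trans (fyx).
  have [P [pathP lastP sizeP]] := dist_attained s y.
  have dsy: dist s y <= f y by apply: IHn; lia.
  apply: (@leq_trans (dist s y).+1) => //.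
  rewrite -sizeP -(size_rcons P x) -{1}(last_rcons s P x).
  by apply: dist_le_size; rewrite rcons_path pathP lastP adj_sym.
have [P [pathP <- <-]] := dist_attained s x.
rewrite -[size P]add0n -[X in X + _]f0.
elim: P s pathP {f0 f_desc} => [|z P IHP] s /=; first by rewrite addn0.
by case/andP=> /f_lip fsz /IHP; lia.
Qed.

(** As many distinct neighbours as the degree exhaust the neighbourhood. *)
Lemma adj_in_neighbours x (N : seq G) :
    uniq N -> all (@adj G x) N -> degree x = size N ->
  forall y, adj x y -> y \in N.
Proof.
move=> uniqN /allP adjN degx y xy.
have subN: N \subset [set y | adj x y].
  by apply/subsetP => z /adjN; rewrite inE.
have /subset_cardP/(_ subN)/(_ y): #|N| = #|[set y | adj x y]|.
  by rewrite (card_uniqP uniqN) -degx.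
by rewrite inE xy.
Qed.

(** One half of the handshake lemma: the map from ordered adjacent pairs to
edges is at most two-to-one. *)
Lemma sum_degree_le : \sum_(x : G) degree x <= 2 * #|edges G|.
Proof.
pose ends (z : G * G) := [set z.1; z.2].
have -> : \sum_(x : G) degree x = \sum_(z : G * G | adj z.1 z.2) 1.
  rewrite -(pair_big_dep xpredT (@adj G) (fun _ _ => 1)) /=.
  apply: eq_bigr => x _; rewrite /degree -sum1_card.
  by apply: eq_bigl => y; rewrite inE.
rewrite (partition_big ends (mem (edges G))) /=; last first.
  by move=> z zadj; apply/imsetP; exists z; rewrite ?inE.
rewrite mulnC -sum_nat_const; apply: leq_sum => e /imsetP[[x y] _ ->].
rewrite sum1_card; apply: leq_trans (card_size [:: (x, y); (y, x)]).
apply/subset_leq_card/subsetP => -[x' y'].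
rewrite -topredE /= /ends !inE /= => /andP[adjxy' /eqP eqe].
have x'y' : x' != y' by apply: contraTneq adjxy' => ->; rewrite adj_irr.
have: x' \in [set x; y] by rewrite -eqe !inE eqxx.
have: y' \in [set x; y] by rewrite -eqe !inE eqxx orbT.
rewrite !inE !xpair_eqE => /orP[]/eqP Ey /orP[]/eqP Ex.
all: by move: x'y'; rewrite Ex Ey ?eqxx ?orbT.
Qed.

Lemma metric_dim_le S : metric_generator S -> metric_dim G <= #|S|.
Proof.
rewrite /metric_dim; case: arg_minnP => [|S0 _ min_S0 /min_S0 //].
exact: metric_generator_setT.
Qed.

End Distance.

(** * The distance function in coordinates *)

(** Position i on branch a (of length A) and position j on branch b (of length
B) denote the same vertex: all branches share their two ends. *)
Definition same_point (A B a i b j : nat) : Prop :=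
  a = b /\ i = j \/ (i = 0 /\ j = 0 \/ i = A /\ j = B).

(** The distance between position i of a branch of length A and position j of a
branch of length B, where p is the length of a shortest branch and [same] tells
whether the two branches coincide.  The four terms are the lengths of the
routes that are direct (through position 0 when the branches differ), through
the end v, through u then v along a shortest branch, and through v then u. *)
Definition theta_dist (p A B : nat) (same : bool) i j : nat :=
  minn (minn (if same then (i - j) + (j - i) else i + j) ((A - i) + (B - j)))
       (minn (i + (p + (B - j))) ((A - i) + (p + j))).

Lemma theta_dist_le p A B (same : bool) i j :
  [/\ theta_dist p A B same i j <= (if same then (i - j) + (j - i) else i + j),
     theta_dist p A B same i j <= (A - i) + (B - j),
     theta_dist p A B same i j <= i + (p + (B - j)) &
     theta_dist p A B same i j <= (A - i) + (p + j)].
Proof. by rewrite !geq_min !leqnn !orbT. Qed.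

Lemma theta_dist_cases p A B (same : bool) i j :
  [\/ theta_dist p A B same i j = (if same then (i - j) + (j - i) else i + j),
     theta_dist p A B same i j = (A - i) + (B - j),
     theta_dist p A B same i j = i + (p + (B - j)) |
     theta_dist p A B same i j = (A - i) + (p + j)].
Proof.
by rewrite /theta_dist /minn; do 3! [case: ifP => _]; by constructor.
Qed.

(** At an inner position other than j, one of the two neighbours along the
branch is closer to j. *)
Lemma theta_dist_desc p A B (same : bool) i j :
    0 < i < A -> (same -> i != j) ->
  theta_dist p A B same i.-1 j < theta_dist p A B same i j \/
  theta_dist p A B same i.+1 j < theta_dist p A B same i j.
Proof.
case/andP=> i_gt0 iA ij.
have [l1 l2 l3 l4] := theta_dist_le p A B same i.-1 j.
have [r1 r2 r3 r4] := theta_dist_le p A B same i.+1 j.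
have [] := theta_dist_cases p A B same i j => ->; last 3 first.
- by right; lia.
- by left; lia.
- by right; lia.
by case: same ij l1 r1 {l2 l3 l4 r2 r3 r4} => [/(_ isT)|_] l1 r1; lia.
Qed.

Lemma theta_dist_lip p A B (same : bool) i j : i < A ->
  theta_dist p A B same i.+1 j <= (theta_dist p A B same i j).+1 /\
  theta_dist p A B same i j <= (theta_dist p A B same i.+1 j).+1.
Proof.
move=> iA; have [l1 l2 l3 l4] := theta_dist_le p A B same i j.
have [r1 r2 r3 r4] := theta_dist_le p A B same i.+1 j.
split.
  case: (theta_dist_cases p A B same i j) => ->; try lia.
  by case: same l1 r1 {l2 l3 l4 r2 r3 r4} => l1 r1; lia.
case: (theta_dist_cases p A B same i.+1 j) => ->; try lia.
by case: same l1 r1 {l2 l3 l4 r2 r3 r4} => l1 r1; lia.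
Qed.

Lemma theta_dist0 p A B (same : bool) j :
  p <= A -> theta_dist p A B same 0 j = minn j (p + (B - j)).
Proof. by rewrite /theta_dist; case: same; lia. Qed.

Lemma theta_dist_len p A B (same : bool) j :
    p <= A -> j <= B -> (same -> A = B) ->
  theta_dist p A B same A j = minn (B - j) (p + j).
Proof. by rewrite /theta_dist; case: same => [pA jB /(_ isT)|]; lia. Qed.

(** * Two vertices that distinguish all positions *)

(** The length of branch a of Theta_{p,q,r}, the branches being numbered 0, 1
and 2. *)
Definition branch_len (p q r a : nat) : nat := nth 0 [:: p; q; r] a.

(** The distance from position j of branch b to position i of branch a. *)
Definition route (p q r b j a i : nat) : nat :=
  theta_dist p (branch_len p q r a) (branch_len p q r b) (a == b) i j.

(** Position j of branch b and position k of branch c distinguish any two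
positions of Theta_{p,q,r} that are different vertices. *)
Definition resolving (p q r b j c k : nat) : Prop :=
  forall a i a' i', a < 3 -> a' < 3 ->
    i <= branch_len p q r a -> i' <= branch_len p q r a' ->
    route p q r b j a i = route p q r b j a' i' ->
    route p q r c k a i = route p q r c k a' i' ->
  same_point (branch_len p q r a) (branch_len p q r a') a i a' i'.

(** Distances from the positions m and m + p of branch 1.  The lists give the
formulas on branches 0, 1 and 2. *)
Lemma route_lt p m e r a i (q := p + m.*2 + e) :
    0 < p -> e <= 1 -> 0 < m + e -> q <= r ->
    a < 3 -> i <= branch_len p q r a ->
  route p q r 1 m a i =
    nth 0 [:: m + i; (m - i) + minn (i - m) (p + m);
              m + minn i (p + (r - i))] a
  /\ route p q r 1 (m + p) a i =
    nth 0 [:: m + minn (p + i) (e + (p - i));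
              (m + p - i) + (i - (m + p));
              m + minn (p + i) (e + (r - i))] a.
Proof.
rewrite /q /route /theta_dist /branch_len => p_gt0 e1 me_gt0 qr.
by case: a => [|[|[|//]]] _ /= ir; split; lia.
Qed.

Lemma resolving_lt p m e r (q := p + m.*2 + e) :
  0 < p -> e <= 1 -> 0 < m + e -> q <= r -> resolving p q r 1 m 1 (m + p).
Proof.
move=> p_gt0 e1 me_gt0 qr a i a' i' a3 a'3 ia ia'.
have [-> ->] := route_lt p_gt0 e1 me_gt0 qr a3 ia.
have [-> ->] := route_lt p_gt0 e1 me_gt0 qr a'3 ia'.
rewrite /same_point /branch_len /q in ia ia' qr *.
case: a a3 ia => [|[|[|//]]] _; (case: a' a'3 ia' => [|[|[|//]]] _);
  rewrite /= => ? ? ? ?.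
(* The match makes lia run separately on each of the nine pairs of branches. *)
all: match goal with |- _ => lia end.
Qed.

(** Distances from position 1 of branches 0 and 2 when p = q. *)
Lemma route_eq p r a i :
    1 < p -> p < r -> a < 3 -> i <= branch_len p p r a ->
  route p p r 0 1 a i =
    nth 0 [:: (i - 1) + (1 - i); minn i.+1 (p.-1 + (p - i));
              minn i.+1 (p.-1 + (r - i))] a
  /\ route p p r 2 1 a i =
    nth 0 [:: minn i.+1 (r.-1 + (p - i)); minn i.+1 (r.-1 + (p - i));
              minn ((i - 1) + (1 - i)) (p.+1 + (r - i))] a.
Proof.
rewrite /route /theta_dist /branch_len => p_gt1 pr.
by case: a => [|[|[|//]]] _ /= ir; split; lia.
Qed.

Lemma resolving_eq p r :
  1 < p -> p < r -> r != p + 2 -> resolving p p r 0 1 2 1.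
Proof.
move=> p_gt1 pr /eqP r_neq a i a' i' a3 a'3 ia ia'.
have [-> ->] := route_eq p_gt1 pr a3 ia.
have [-> ->] := route_eq p_gt1 pr a'3 ia'.
rewrite /same_point /branch_len in ia ia' *.
case: a a3 ia => [|[|[|//]]] _; (case: a' a'3 ia' => [|[|[|//]]] _);
  rewrite /= => ? ? ? ?.
(* The match makes lia run separately on each of the nine pairs of branches. *)
all: match goal with |- _ => lia end.
Qed.

(** * Coordinates in a Theta-graph *)

Section ThetaStructure.
Variables (G : graph) (u v : G) (br : nat -> seq G).
Hypothesis uv : u != v.
Hypothesis deg_u : degree u = 3.
Hypothesis deg_v : degree v = 3.
Hypothesis deg_other : forall x, x != u -> x != v -> degree x = 2.
Hypothesis br_path : forall a, a < 3 -> is_path u v (br a).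
Hypothesis br_disjoint :
  forall a b, a < 3 -> b < 3 -> a != b -> internally_disjoint u (br a) (br b).

Local Notation len a := (size (br a)).

(** The vertex at position i of branch a; it is u at 0, since [br a] lists the
vertices that follow u. *)
Definition point a i : G := nth u (u :: br a) i.

Lemma point_len a : a < 3 -> point a (len a) = v.
Proof. by case/br_path/and3P => _ _ /eqP <-; rewrite (last_nth u). Qed.

Lemma len_gt0 a : a < 3 -> 0 < len a.
Proof.
move/point_len; rewrite /point; case: (br a) => //= uv'.
by move: uv; rewrite uv' eqxx.
Qed.

Lemma point_inj a i j :
  a < 3 -> i <= len a -> j <= len a -> point a i = point a j -> i = j.
Proof.
case/br_path/and3P => _ uniq_br _ ia ja /eqP.
by rewrite nth_uniq // => /eqP.
Qed.

Lemma point_interior a i :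
  a < 3 -> 0 < i < len a -> point a i \in interior u (br a).
Proof.
move=> a3; have := len_gt0 a3; rewrite /point /interior.
case/lastP: (br a) => // s z _; rewrite belast_rcons size_rcons /=.
case: i => //= i; rewrite ltnS => i_s.
by rewrite nth_rcons i_s mem_nth.
Qed.

Lemma point_eq a i b j :
    a < 3 -> b < 3 -> i <= len a -> j <= len b ->
  point a i = point b j -> same_point (len a) (len b) a i b j.
Proof.
move=> a3 b3 ia jb eq_ij; rewrite /same_point.
have [eq_ab | neq_ab] := eqVneq a b.
  subst b; left; split=> //; exact: point_inj eq_ij.
right; have [i0 | i_gt0] := posnP i.
  by left; split=> //; apply: (@point_inj b) => //; rewrite -eq_ij i0.
have [j0 | j_gt0] := posnP j.
  by left; split=> //; apply: (@point_inj a) => //; rewrite eq_ij j0.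
have [iA | i_neqA] := eqVneq i (len a).
  right; split=> //; apply: (@point_inj b) => //.
  by rewrite -eq_ij iA !point_len.
have [jB | j_neqB] := eqVneq j (len b).
  right; split=> //; apply: (@point_inj a) => //.
  by rewrite eq_ij jB !point_len.
have /andP[_ /pred0P/(_ (point a i))] := br_disjoint a3 b3 neq_ab.
rewrite /= {2}eq_ij !point_interior //; lia.
Qed.

(** At most one branch consists of the single edge uv. *)
Lemma len1_inj a b : a < 3 -> b < 3 -> len a = 1 -> len b = 1 -> a = b.
Proof.
move=> a3 b3 a1 b1; apply/eqP/idPn => /(br_disjoint a3 b3)/andP[/eqP[]].
have := point_len a3; have := point_len b3; rewrite /point a1 b1 /=.
by case: (br a) (br b) a1 b1 => [|x []] // [|y []] //= _ _ -> ->.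
Qed.

Lemma adj_point a i : a < 3 -> i < len a -> adj (point a i) (point a i.+1).
Proof. by case/br_path/and3P => /(pathP u)adj_br _ _ /adj_br. Qed.

(** The vertices x and y are at successive positions of some branch. *)
Definition consecutive x y : Prop :=
  exists a i, [/\ a < 3, i < len a &
    x = point a i /\ y = point a i.+1 \/ x = point a i.+1 /\ y = point a i].

(** Every edge at a vertex of a branch lies on a branch: the branches through
that vertex already account for its whole degree. *)
Lemma adj_point_consecutive a i y :
  a < 3 -> i <= len a -> adj (point a i) y -> consecutive (point a i) y.
Proof.
move=> a3 ia; have [-> {i ia} | i_gt0] := posnP i.
  pose N := [:: point 0 1; point 1 1; point 2 1].
  have adjN : all (@adj G u) N.
    by rewrite /= !(@adj_point _ 0) ?len_gt0.
  have uniqN : uniq N.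
    suff neqN c d : c < 3 -> d < 3 -> c != d -> point c 1 != point d 1.
      by rewrite /= !inE !negb_or !neqN.
    move=> c3 d3 cd; apply/eqP => /point_eq.
    rewrite !len_gt0 // => /(_ c3 d3 isT isT); rewrite /same_point.
    by have := @len1_inj c d c3 d3; lia.
  move/(adj_in_neighbours uniqN adjN deg_u); rewrite !inE.
  by case/or3P => /eqP->; [exists 0, 0 | exists 1, 0 | exists 2, 0];
    rewrite len_gt0; split=> //; left.
have [-> {i i_gt0 ia} | i_neqA] := eqVneq i (len a).
  pose N := [:: point 0 (len 0).-1; point 1 (len 1).-1; point 2 (len 2).-1].
  have adj_last c : c < 3 -> adj v (point c (len c).-1).
    move=> c3; rewrite adj_sym -(point_len c3).
    by rewrite -{2}(prednK (len_gt0 c3)) adj_point // prednK ?len_gt0.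
  have adjN : all (@adj G v) N by rewrite /= !adj_last.
  have uniqN : uniq N.
    suff neqN c d : c < 3 -> d < 3 -> c != d ->
        point c (len c).-1 != point d (len d).-1.
      by rewrite /= !inE !negb_or !neqN.
    move=> c3 d3 cd; apply/eqP => /point_eq.
    rewrite !leq_pred // => /(_ c3 d3 isT isT).
    have := len_gt0 c3; have := len_gt0 d3; rewrite /same_point => d0 c0 H.
    by have := @len1_inj c d c3 d3; lia.
  rewrite (point_len a3) => /(adj_in_neighbours uniqN adjN deg_v); rewrite !inE.
  have step c : c < 3 -> y = point c (len c).-1 -> consecutive v y.
    move=> c3 ->; exists c, (len c).-1; rewrite prednK ?len_gt0 // point_len //.
    by split=> //; right.
  by case/or3P => /eqP; apply: step.
pose N := [:: point a i.-1; point a i.+1].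
have adjN : all (@adj G (point a i)) N.
  rewrite /= adj_point ?andbT ?(adj_sym (point a i)) //; last lia.
  by rewrite -{2}(prednK i_gt0) adj_point //; lia.
have uniqN : uniq N.
  rewrite /= inE andbT; apply/eqP => /(@point_inj a); lia.
have degN : degree (point a i) = 2.
  apply: deg_other; apply/eqP.
    by move/(@point_inj a i 0); lia.
  by rewrite -(point_len a3) => /(@point_inj a i (len a)); lia.
move/(adj_in_neighbours uniqN adjN degN); rewrite !inE.
case/orP => /eqP->; last by exists a, i; split=> //; [lia | left].
exists a, i.-1; rewrite prednK //; split=> //; by right.
Qed.

(** Every vertex lies on a branch, since the graph is connected. *)
Lemma point_onto x : exists z : nat * nat,
  [/\ z.1 < 3, z.2 <= len z.1 & x = point z.1 z.2].
Proof.
have /connectP[P pathP ->] := graph_connected u x.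
have: exists z : nat * nat, [/\ z.1 < 3, z.2 <= len z.1 & u = point z.1 z.2].
  by exists (0, 0).
elim: P {x} u pathP => //= y P IHP x /andP[xy pathP] [[a i] /= [a3 ia Ex]].
apply: IHP => //; rewrite Ex in xy.
have [b [j [b3 jb]]] := adj_point_consecutive a3 ia xy.
by case=> -[_ ->]; [exists (b, j.+1) | exists (b, j)]; split=> //=; apply: ltnW.
Qed.

Hypothesis br0_min : forall a, a < 3 -> len 0 <= len a.

(** The distance is given by the formula in coordinates. *)
Lemma dist_point b j a i : b < 3 -> j <= len b -> a < 3 -> i <= len a ->
  dist (point b j) (point a i) =
    theta_dist (len 0) (len a) (len b) (a == b) i j.
Proof.
move=> b3 jb a3 ia.
(* The candidate distance is read off coordinates chosen for each vertex; it
   does not depend on the choice made for u and v. *)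
have [coord coordP] := fin_all_exists point_onto.
pose F c k := theta_dist (len 0) (len c) (len b) (c == b) k j.
pose f x := F (coord x).1 (coord x).2.
have len_b c : c == b -> len c = len b by move/eqP->.
have f_point c k : c < 3 -> k <= len c -> f (point c k) = F c k.
  move=> c3 kc; have [] := coordP (point c k).
  rewrite /f; case: (coord _) => d l /= d3 ld /point_eq.
  case/(_ c3 d3 kc ld) => [[-> ->] // | [] [-> ->]]; rewrite /F.
    by rewrite !theta_dist0 ?br0_min.
  by rewrite !theta_dist_len ?br0_min //; apply: len_b.
rewrite -/(F a i) -f_point //; apply: dist_potential.
- by rewrite f_point // /F eqxx /theta_dist; lia.
- move=> x y; have [c3 kc ->] := coordP x; move/(adj_point_consecutive c3 kc).
  case=> d [l [d3 ld]] [] [-> ->]; rewrite !f_point ?(ltnW ld) // /F.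
    exact: (theta_dist_lip _ _ _ _ ld).1.
  exact: (theta_dist_lip _ _ _ _ ld).2.
have adjC d l : d < 3 -> l < len d -> adj (point d l.+1) (point d l).
  by move=> d3 ld; rewrite adj_sym adj_point.
have len_gt0 := len_gt0.
have step d l x : d < 3 -> l <= len d -> adj x (point d l) -> F d l < f x ->
    exists2 y, adj x y & f y < f x.
  by move=> d3 ld xy lt_f; exists (point d l); rewrite // f_point.
move=> x; have [c3 kc ->] := coordP x.
case: (coord x) c3 kc => c k /= c3 kc neq.
have B0 := len_gt0 b b3; have p0 := len_gt0 0 isT; have pB := br0_min b3.
(* At u, the distance decreases along branch b or along the shortest branch 0,
   towards v; the situation at v is symmetric. *)
have [k0 | k_gt0] := posnP k.
  rewrite k0 in neq *.
  have j_gt0 : 0 < j by case: posnP neq => // ->; rewrite eqxx.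
  have Fc : f (point c 0) = minn j (len 0 + (len b - j)).
    by rewrite f_point // /F theta_dist0 ?br0_min.
  have [le_j | lt_j] := leqP j (len 0 + (len b - j)).
    apply: (step b 1) => //; first exact: (@adj_point b 0).
    by rewrite Fc /F eqxx /theta_dist; lia.
  apply: (step 0 1) => //; first exact: (@adj_point 0 0).
  by rewrite Fc /F /theta_dist; lia.
have [kC | k_neqC] := eqVneq k (len c).
  rewrite kC in neq *.
  have j_ltB : j < len b.
    rewrite ltn_neqAle jb andbT; apply: contraNneq neq => ->.
    by rewrite !point_len.
  have Fc : f (point c (len c)) = minn (len b - j) (len 0 + j).
    by rewrite f_point // /F theta_dist_len ?br0_min //; apply: len_b.
  rewrite (point_len c3) in Fc *.
  have [le_j | lt_j] := leqP (len b - j) (len 0 + j).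
    apply: (step b (len b).-1) => //; first exact: leq_pred.
      by rewrite -(point_len b3) -{1}(prednK B0) adjC // prednK.
    by rewrite Fc /F eqxx /theta_dist; lia.
  apply: (step 0 (len 0).-1) => //; first exact: leq_pred.
    by rewrite -(@point_len 0) // -{1}(prednK p0) adjC // prednK.
  have E0 := @len_b 0; rewrite Fc /F /theta_dist.
  by case: eqP E0 => [_ /(_ isT) | _ _]; lia.
have k_ltC : k < len c by rewrite ltn_neqAle k_neqC.
have neq_kj : c == b -> k != j.
  by move/eqP=> cb; apply: contraNneq neq => ->; rewrite cb.
have [lt_f | lt_f] : F c k.-1 < F c k \/ F c k.+1 < F c k.
- by apply: theta_dist_desc => //; rewrite k_gt0.
- apply: (step c k.-1) => //; rewrite ?f_point //; first lia.
  by rewrite -{1}(prednK k_gt0) adjC // prednK.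
- by apply: (step c k.+1); rewrite ?f_point // adj_point.
Qed.

Lemma same_point_eq a i b j : a < 3 -> b < 3 ->
  same_point (len a) (len b) a i b j -> point a i = point b j.
Proof.
by move=> a3 b3 [[-> ->] // | [[-> ->] // | [-> ->]]]; rewrite !point_len.
Qed.

Lemma metric_dim_le2 b j c k : b < 3 -> j <= len b -> c < 3 -> k <= len c ->
  resolving (len 0) (len 1) (len 2) b j c k -> metric_dim G <= 2.
Proof.
move=> b3 jb c3 kc res.
apply: leq_trans (_ : #|[set point b j; point c k]| <= 2); last first.
  by rewrite cards2; case: (_ != _).
apply/metric_dim_le/forallP => x; apply/forallP => y.
apply/implyP; apply: contraNT; rewrite negb_exists => /forallP no_dist.
have same s : s \in [set point b j; point c k] -> dist s x = dist s y.
  by move=> sS; apply/eqP; have := no_dist s; rewrite sS negbK.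
have [[a i] /= [a3 ia Ex]] := point_onto x.
have [[d l] /= [d3 ld Ey]] := point_onto y.
have lenE e : e < 3 -> branch_len (len 0) (len 1) (len 2) e = len e.
  by case: e => [|[|[|]]].
have routeE e n f m : e < 3 -> n <= len e -> f < 3 -> m <= len f ->
    route (len 0) (len 1) (len 2) e n f m = dist (point e n) (point f m).
  by move=> *; rewrite dist_point // /route !lenE.
have := res a i d l a3 d3; rewrite !lenE // !routeE // -Ex -Ey.
rewrite !same ?inE ?eqxx ?orbT // => /(_ ia ld erefl erefl).
by rewrite Ex Ey => /same_point_eq->.
Qed.

Lemma cyclomatic_ge2 : (2%:Z <= cyclomatic G)%R.
Proof.
have := sum_degree_le G; rewrite /cyclomatic.
have -> : \sum_(x : G) degree x = \sum_(x : G) (2 + ((x == u) + (x == v))).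
  apply: eq_bigr => x _.
  have [-> | xu] := eqVneq x u; first by rewrite (negPf uv) deg_u.
  by have [-> | xv] := eqVneq x v; rewrite ?deg_v ?deg_other.
have sum_delta (w : G) : \sum_(x : G) (x == w : nat) = 1.
  by rewrite (bigD1 w) //= eqxx big1 // => x /negPf->.
rewrite !big_split /= !sum_delta sum_nat_const; set V := #|_|; lia.
Qed.

End ThetaStructure.

Theorem corollary15 (G : graph) :
  theta_graph G ->
  (forall p : nat, ~ is_theta G p p p /\ ~ is_theta G p p (p + 2)%N) ->
  ((metric_dim G)%:Z < 2 * cyclomatic G - 1)%R.
Proof.
move=> [p [q [r Gtheta]]] not_exceptional; have := Gtheta.
case=> /andP[pq qr] [u [v [P [Q [R [uv [deg_u deg_v] deg_other]]]]]].
case=> pathP pathQ pathR [[disjPQ disjPR disjQR] [sizeP sizeQ sizeR]].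
pose br := nth [::] [:: P; Q; R].
have br_path a : a < 3 -> is_path u v (br a) by case: a => [|[|[|]]].
have disjC S T : internally_disjoint u S T -> internally_disjoint u T S.
  by rewrite /internally_disjoint eq_sym disjoint_sym.
have br_disjoint a b : a < 3 -> b < 3 -> a != b ->
    internally_disjoint u (br a) (br b).
  case: a => [|[|[|//]]] _; (case: b => [|[|[|//]]] _) => // _;
    exact: disjC.
have br0_min a : a < 3 -> size (br 0) <= size (br a).
  case: a => [|[|[|//]]] _ /=; rewrite ?sizeP ?sizeQ ?sizeR; lia.
have cyclo := cyclomatic_ge2 uv deg_u deg_v deg_other.
have p_gt0 : 0 < p by rewrite -sizeP (len_gt0 uv br_path (a := 0)).
have q_gt1 : 1 < q.
  (* Otherwise p = q = 1 and the edge uv would be used twice. *)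
  have := @len1_inj _ _ _ _ br_path br_disjoint 0 1 isT isT.
  by rewrite /= sizeP sizeQ; lia.
suff: metric_dim G <= 2 by lia.
have dim_le2 := @metric_dim_le2 _ _ _ _ uv deg_u deg_v deg_other br_path
  br_disjoint br0_min.
rewrite /= sizeP sizeQ sizeR in dim_le2.
have [lt_pq | le_qp] := ltnP p q.
  (* m and m + p are the halves, rounded down, of q - p and q + p. *)
  pose m := (q - p)./2; pose e := odd (q - p) : nat.
  have Eq : q = p + m.*2 + e.
    by rewrite /m /e; have := odd_double_half (q - p); lia.
  apply: (dim_le2 1 m 1 (m + p)) => //=; rewrite ?sizeQ; try lia.
  by rewrite Eq; apply: resolving_lt; rewrite /e; lia.
have Eqp : q = p by lia.
subst q; rewrite Eqp in Gtheta qr dim_le2.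
have r_neq : r != p /\ r != p + 2.
  have [no_pp no_pp2] := not_exceptional p.
  by split; apply/eqP => Er; rewrite Er in Gtheta.
apply: (dim_le2 0 1 2 1) => //=; rewrite ?sizeP ?sizeR; try lia.
by apply: resolving_eq; lia.
Qed.
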